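(* Let $a\in\mathbb{C}^k$ and let $Z_1,\dots,Z_k$ be independent random vectors, each uniformly distributed on the real unit sphere $S^{L-1}=\{z\in\mathbb{R}^L:\|z\|_2=1\}$. Then for every $u>1$, $$\mathbb{P}\Big(\Big\|\sum_{j=1}^k a_jZ_j\Big\|_2\ge u\|a\|_2\Big)\le \exp\Big(-\frac{L}{2}\big(u^2-\log(u^2)-1\big)\Big).$$
   Formalization: The formal theorem assumes that a is nonzero; for a = 0 the event has probability 1 while the claimed bound is strictly less than 1, so the statement fails there. *)

(* Defs.v *)
From HB Require Import structures.
From mathcomp Require Import all_boot all_order all_algebra.
From mathcomp Require Import all_classical all_reals all_analysis.
From mathcomp Require Import complex.
Set Implicit Arguments. Unset Strict Implicit. Unset Printing Implicit Defensive.
Import Order.TTheory GRing.Theory Num.Theory.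
Local Open Scope classical_set_scope.
Local Open Scope ring_scope.

Section Defs.
Variable R : realType.

Definition rnorm (L : nat) (v : 'I_L -> R) : R := Num.sqrt (\sum_(i < L) v i ^+ 2).

Definition cnorm (L : nat) (v : 'I_L -> R[i]) : R :=
  Num.sqrt (\sum_(i < L) (complex.Re (v i) ^+ 2 + complex.Im (v i) ^+ 2)).

Definition borelRn (L : nat) : set (set ('I_L -> R)) :=
  <<s [set (fun v : 'I_L -> R => v i) @^-1` B | i in [set: 'I_L] & B in [set B : set R | measurable B]] >>.

Definition box (L : nat) (a b : 'I_L -> R) : set ('I_L -> R) :=
  [set v | forall i, a i <= v i <= b i].
Definition boxvol (L : nat) (a b : 'I_L -> R) : R := \prod_(i < L) (b i - a i).

Definition lebRn (L : nat) (E : set ('I_L -> R)) : \bar R :=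
  ereal_inf [set s : \bar R | exists a b : nat -> 'I_L -> R,
     [/\ (forall n i, a n i <= b n i),
         E `<=` \bigcup_n box (a n) (b n) &
         s = (\sum_(0 <= n <oo) (boxvol (a n) (b n))%:E)%E]].

Definition sphere (L : nat) : set ('I_L -> R) := [set v | rnorm v = 1].
Definition ball1 (L : nat) : set ('I_L -> R) := [set v | rnorm v <= 1].

Definition cone (L : nat) (A : set ('I_L -> R)) : set ('I_L -> R) :=
  [set v | exists t x, [/\ 0 < t <= 1, A x & v = (fun i => t * x i)]].

(* The uniform distribution (normalized surface measure) on S^{L-1}, given
   as the cone measure: sigma(B) = vol(cone (B /\ S^{L-1})) / vol(ball).
   X : Omega -> R^L is uniformly distributed on S^{L-1} iff for every Borel
   set B, P(X in B) * vol(ball) = vol(cone(B /\ S^{L-1})). *)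
Definition uniform_on_sphere d (Omega : measurableType d)
    (P : probability Omega R) (L : nat) (X : Omega -> 'I_L -> R) : Prop :=
  forall B, borelRn B ->
    (P (X @^-1` B) * lebRn (@ball1 L) = lebRn (cone (B `&` @sphere L)))%E.

Definition indep_vectors d (Omega : measurableType d)
    (P : probability Omega R) (k L : nat) (X : 'I_k -> Omega -> 'I_L -> R) : Prop :=
  forall B : 'I_k -> set ('I_L -> R), (forall j, borelRn (B j)) ->
    P (\bigcap_(j in [set: 'I_k]) (X j @^-1` B j)) = (\prod_(j < k) P (X j @^-1` B j))%E.

End Defs.

(* Main.v *)
Require Import Defs.
From HB Require Import structures.
From mathcomp Require Import all_boot all_order all_algebra.
From mathcomp Require Import all_classical all_reals all_analysis.
From mathcomp Require Import complex.
From mathcomp Require Import measurable_realfun ring lra.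
Import Order.TTheory GRing.Theory Num.Theory.
Import numFieldNormedType.Exports.
Local Open Scope classical_set_scope.
Local Open Scope ring_scope.
Set Implicit Arguments. Unset Strict Implicit. Unset Printing Implicit Defensive.

(** By Markov's inequality it suffices to bound E exp(t |sum_j a_j Z_j|^2) by
    (1 - 2 t |a|^2 / L)^(-L/2), the bound that holds for Gaussian vectors, and to
    take t = L (1 - u^-2) / (2 |a|^2).

    The summands are integrated one at a time. Since |Z| = 1,
    |x + a Z|^2 = |x|^2 + |a|^2 + 2 <Re (conj a x), Z>, so the sub-Gaussian bound
    E exp <v, Z> <= exp (|v|^2 / (2L)) gives
    E exp(t |x + a Z|^2) <= exp(t |a|^2) exp((t + 2 t^2 |a|^2 / L) |x|^2),
    and t + 2 t^2 |a|^2 / L <= t / (1 - 2 t |a|^2 / L).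

    For the sub-Gaussian bound, E exp <v, Z> depends on |v| only, so v may be
    replaced by a vector with all coordinates +-|v|/sqrt L; averaging over the
    signs gives E prod_l cosh(|v| Z_l / sqrt L) <= exp(|v|^2 |Z|^2 / (2L)), where
    |Z|^2 = 1.

    Invariance of the cone measure under rotations reduces to that of the outer
    measure [lebRn] under shears, three of which make up a plane rotation; it
    passes to the law of Z because the ball has positive finite volume. *)

(** * The outer measure [lebRn] and its invariance *)

Lemma boxvol_ge0 (R : realType) (L : nat) (a b : 'I_L -> R) :
  (forall i, a i <= b i) -> 0 <= boxvol a b.
Proof. by move=> ab; apply: prodr_ge0 => i _; rewrite subr_ge0. Qed.

Lemma lebRn_ge0 (R : realType) (L : nat) (E : set ('I_L -> R)) :
  (0 <= lebRn E)%E.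
Proof.
apply/le_ereal_inf_tmp => _ [a [b [ab _ ->]]].
by apply: nneseries_ge0 => n _ _; rewrite lee_fin boxvol_ge0.
Qed.

Lemma le_lebRn (R : realType) (L : nat) (E F : set ('I_L -> R)) :
  E `<=` F -> (lebRn E <= lebRn F)%E.
Proof.
move=> EF; apply: ereal_inf_le_tmp => _ [a [b [ab Fc ->]]].
by exists a, b; split=> //; exact: subset_trans Fc.
Qed.

(** The double family is reindexed along a bijection between [nat] and [nat * nat]. The unordered
    sum [esum] of nonnegative terms does not see the reindexing and can be regrouped row by row. *)
Lemma lebRn_cover2 (R : realType) (L : nat) (a b : nat -> nat -> 'I_L -> R)
    (E : set ('I_L -> R)) :
  (forall n m i, a n m i <= b n m i) ->
  E `<=` \bigcup_n \bigcup_m box (a n m) (b n m) ->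
  (lebRn E <= \sum_(0 <= n <oo) \sum_(0 <= m <oo) (boxvol (a n m) (b n m))%:E)%E.
Proof.
move=> ab Ec.
pose v (p : nat * nat) := (boxvol (a p.1 p.2) (b p.1 p.2))%:E.
have v0 p : (0 <= v p)%E by rewrite lee_fin boxvol_ge0.
apply: (@le_trans _ _ (\esum_(i in setT) v i)%E).
  have /card_esym/ppcard_eqP[f] := card_nat2.
  apply: ereal_inf_lbound => /=.
  exists (fun n => a (f n).1 (f n).2), (fun n => b (f n).1 (f n).2); split=> //.
    move=> x /Ec[n _ [m _ xnm]]; exists (f^-1%FUN (n, m)) => //=.
    by rewrite invK ?inE.
  have := @esum_pred_image _ _ v f xpredT (fun n _ => v0 _).
  rewrite ?[fun=> _]set_true image_eq => ->//.
rewrite (_ : esum _ _ = (\sum_(0 <= n <oo) \sum_(0 <= m <oo) v (n, m))%E)//.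
pose J : nat -> set (nat * nat) := fun i => [set (i, j) | j in setT].
rewrite (_ : setT = \bigcup_k J k); last first.
  by rewrite predeqE => -[n m]; split => // _; exists n => //; exists m.
rewrite esum_bigcupT //=; last first.
  apply/trivIsetP => i j _ _ ij.
  rewrite predeqE => -[n m] /=; split => //= -[] [_] _ [<-{n} _].
  by move=> [m' _] [] /esym/eqP; rewrite (negbTE ij).
rewrite -(image_id [set: nat]) -fun_true esum_pred_image//; last first.
  by move=> n _; exact: esum_ge0.
apply: eq_eseriesr => /= j _.
rewrite -(esum_pred_image v (pair j) predT)//=; last first.
  by move=> ? ? _ _; exact: (@can_inj _ _ _ snd).
by congr esum; rewrite predeqE => -[n m]; split; move=> [i _ <-]; exists i.
Qed.

Lemma lebRn_sigma_subadditive (R : realType) (L : nat)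
    (F : nat -> set ('I_L -> R)) (E : set ('I_L -> R)) :
  E `<=` \bigcup_n F n -> (lebRn E <= \sum_(0 <= n <oo) lebRn (F n))%E.
Proof.
move=> EF; have [[i ioo]|] := pselect (exists i, lebRn (F i) = +oo%E).
  rewrite (eseries_pinfty _ _ ioo) ?leey// => n _.
  by rewrite -ltNye (lt_le_trans _ (lebRn_ge0 _)).
rewrite -forallNE => Foo.
apply/lee_addgt0Pr => e e0.
apply: le_trans (epsilon_trick _ _ (ltW e0)); last by move=> n; exact: lebRn_ge0.
(* Each piece has finite outer measure here, so it has a cover that is optimal up to e / 2^(n+1);
   these errors add up to e. *)
pose Q n (p : (nat -> 'I_L -> R) * (nat -> 'I_L -> R)) :=
  [/\ (forall m i, p.1 m i <= p.2 m i), F n `<=` \bigcup_m box (p.1 m) (p.2 m) &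
  (\sum_(0 <= m <oo) (boxvol (p.1 m) (p.2 m))%:E <=
   lebRn (F n) + (e / (2 ^ n.+1)%:R)%:E)%E].
have [G QG] : {G & forall n, Q n (G n)}.
  apply: (@choice _ _ Q) => n; rewrite /Q.
  have en : 0 < e / (2 ^ n.+1)%:R by rewrite divr_gt0// ltr0n expn_gt0.
  have fn : lebRn (F n) \is a fin_num.
    by rewrite ge0_fin_numE ?lebRn_ge0// ltey; apply/eqP; exact: Foo.
  have [_ [a [b [ab Fc ->]]] /ltW le] := lb_ereal_inf_adherent en fn.
  by exists (a, b).
apply: le_trans (lebRn_cover2 (a := fun n => (G n).1) (b := fun n => (G n).2) _ _) _.
- by move=> n m i; have [+ _ _] := QG n; exact.
- by move=> x /EF[n _ Fx]; exists n => //; have [_ + _] := QG n; exact.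
apply: lee_nneseries => n _; last by have [_ _] := QG n.
move=> _; apply: nneseries_ge0 => m _ _; rewrite lee_fin boxvol_ge0//.
by have [+ _ _] := QG n.
Qed.

(** The finite family is padded with the degenerate box at the origin. Its volume is zero only
    because L > 0: an empty product would be 1. *)
Lemma lebRn_finite_cover (R : realType) (L N : nat) (a b : nat -> 'I_L -> R)
    (E : set ('I_L -> R)) : (0 < L)%N ->
  (forall n i, (n < N)%N -> a n i <= b n i) ->
  E `<=` [set x | exists2 n, (n < N)%N & box (a n) (b n) x] ->
  (lebRn E <= (\sum_(n < N) boxvol (a n) (b n))%:E)%E.
Proof.
move=> L0 ab Ec.
pose c (f : nat -> 'I_L -> R) n i : R := if (n < N)%N then f n i else 0.
apply: ereal_inf_lbound; exists (c a), (c b); split.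
- by move=> n i; rewrite /c; case: ifPn => // nN; exact: ab.
- by move=> x /Ec[n nN xn]; exists n => //; rewrite /c /= => i; rewrite nN.
rewrite (nneseries_split 0 N)//; last first.
  move=> k _; rewrite lee_fin boxvol_ge0// => i; rewrite /c.
  by case: ifPn => // nN; exact: ab.
rewrite add0n eseries0 ?adde0; last first.
  move=> i; rewrite /= => iN _; rewrite /boxvol /c ltnNge iN/=.
  by rewrite (bigD1 (Ordinal L0))//= subrr mul0r.
rewrite big_mkord -sumEFin; apply: eq_bigr => n _.
by rewrite /boxvol /c ltn_ord.
Qed.

Lemma lebRn_box (R : realType) (L : nat) (a b : 'I_L -> R) : (0 < L)%N ->
  (forall i, a i <= b i) -> (lebRn (box a b) <= (boxvol a b)%:E)%E.
Proof.
move=> L0 ab.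
have := @lebRn_finite_cover R L 1 (fun=> a) (fun=> b) (box a b) L0.
by rewrite big_ord1; apply => // x xb; exists 0%N.
Qed.

(** A cover of E by boxes is carried to a cover of T(E) by images of boxes, so countable
    subadditivity reduces the bound to a single box. *)
Lemma lebRn_image_le (R : realType) (L : nat) (T : ('I_L -> R) -> 'I_L -> R)
    (E : set ('I_L -> R)) :
  (forall a b, (forall i, a i <= b i) ->
     (lebRn (T @` box a b) <= (boxvol a b)%:E)%E) ->
  (lebRn (T @` E) <= lebRn E)%E.
Proof.
move=> Tbox; apply/le_ereal_inf_tmp => _ [a [b [ab Ec ->]]].
apply: le_trans (_ : (_ <= \sum_(0 <= n <oo) lebRn (T @` box (a n) (b n)))%E) _.
  apply: lebRn_sigma_subadditive => _ [x /Ec[n _ xn] <-].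
  by exists n => //; exists x.
apply: lee_nneseries => n _; first by move=> _; exact: lebRn_ge0.
exact: Tbox.
Qed.

Definition flip (R : realType) (L : nat) (e : pred 'I_L) (x : 'I_L -> R) : 'I_L -> R :=
  fun l => if e l then - x l else x l.

Lemma lebRn_flip (R : realType) (L : nat) (e : pred 'I_L) (E : set ('I_L -> R)) :
  (0 < L)%N -> (lebRn (flip e @` E) <= lebRn E)%E.
Proof.
move=> L0; apply: lebRn_image_le => a b ab.
pose a' l := if e l then - b l else a l.
pose b' l := if e l then - a l else b l.
have -> : boxvol a b = boxvol a' b'.
  apply: eq_bigr => l _; rewrite /a' /b'; case: ifPn => // _.
  by rewrite opprK addrC.
apply: le_trans (lebRn_box L0 _); last first.
  by move=> l; rewrite /a' /b'; case: ifPn; rewrite ?lerN2.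
apply: le_lebRn => _ [x xab <-] l; have /andP[al bl] := xab l.
by rewrite /a' /b' /flip; case: ifPn => _; rewrite ?lerN2 ?al ?bl.
Qed.

Definition shear (R : realType) (L : nat) (i j : 'I_L) (t : R)
    (x : 'I_L -> R) : 'I_L -> R :=
  fun l => if l == i then x i + t * x j else x l.

Lemma exists_slab (R : realType) (N : nat) (y e : R) :
  0 <= y <= e *+ N.+1 -> exists2 m, (m < N.+1)%N & e *+ m <= y <= e *+ m.+1.
Proof.
elim: N => [|N IH] /andP[y0 yN]; first by exists 0%N; rewrite // mulr0n y0.
have [yle|/ltW yge] := leP y (e *+ N.+1).
  by have [|m mN ym] := IH; [rewrite y0|exists m => //; exact: ltnW].
by exists N.+1 => //; rewrite yge.
Qed.

(* Cutting a box into N slabs orthogonal to e_j, each sheared slab lies in a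
   box whose i-th side grew by 2 |t| (b_j - a_j) / N only. *)
Lemma lebRn_shear (R : realType) (L : nat) (i j : 'I_L) (t : R)
    (E : set ('I_L -> R)) : i != j ->
  (lebRn (shear i j t @` E) <= lebRn E)%E.
Proof.
move=> ij; have L0 : (0 < L)%N by case: L i j ij E => // -[].
apply: lebRn_image_le => a b ab.
pose h := b j - a j.
have h0 : 0 <= h by rewrite subr_ge0.
pose Q := \prod_(l < L | (l != i) && (l != j)) (b l - a l).
have Q0 : 0 <= Q by apply: prodr_ge0 => l _; rewrite subr_ge0.
have volQ (c d : 'I_L -> R) : (forall l, l != i -> l != j -> d l - c l = b l - a l) ->
    boxvol c d = (d i - c i) * ((d j - c j) * Q).
  move=> cd; rewrite /boxvol (bigD1 i)//= (bigD1 j) 1?eq_sym//=.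
  by congr (_ * (_ * _)); apply: eq_bigr => l /andP[]; exact: cd.
have slabs N : (lebRn (shear i j t @` box a b) <=
    (boxvol a b + 2 * `|t| * h * h * Q / N.+1%:R)%:E)%E.
  pose e := h / N.+1%:R.
  have e0 : 0 <= e by rewrite divr_ge0.
  have eN : e *+ N.+1 = h by rewrite -mulr_natr /e divfK// pnatr_eq0.
  (* On the m-th slab x_j lies within e of a_j + e m, so t x_j lies within |t| e of t (a_j + e m).
     The i-th side is shifted by that value and widened by |t| e at both ends. *)
  pose c m l := if l == i then a i + t * (a j + e *+ m) - `|t| * e
                else if l == j then a j + e *+ m else a l.
  pose d m l := if l == i then b i + t * (a j + e *+ m) + `|t| * e
                else if l == j then a j + e *+ m.+1 else b l.
  have te0 : 0 <= `|t| * e by rewrite mulr_ge0.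
  have vm m : boxvol (c m) (d m) = (b i - a i + 2 * `|t| * e) * (e * Q).
    rewrite volQ; last first.
      by move=> l li lj; rewrite /c /d (negPf li) (negPf lj).
    rewrite /c /d eqxx eq_sym (negPf ij) eqxx mulrS; ring.
  have -> : boxvol a b + 2 * `|t| * h * h * Q / N.+1%:R
      = \sum_(m < N.+1) boxvol (c m) (d m).
    under eq_bigr do rewrite vm.
    rewrite sumr_const card_ord (volQ a b)// -/h -mulrnAr -mulrnAl eN /e; ring.
  apply: lebRn_finite_cover => //.
    move=> m l _; rewrite /c /d; case: ifPn => _; first by have := ab i; lra.
    by case: ifPn => // _; rewrite lerD2l mulrS lerDr.
  move=> _ [x xab <-].
  have [|m mN /andP[ym1 ym2]] := @exists_slab R N (x j - a j) e.
    by have /andP[xa xb] := xab j; rewrite eN subr_ge0 xa lerB.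
  exists m => // l; rewrite /c /d /shear; case: ifPn => [_|_].
    have /andP[xa xb] := xab i.
    have : `|t * (x j - (a j + e *+ m))| <= `|t| * e.
      rewrite normrM ler_wpM2l// ler_norml; apply/andP; split; last first.
        by move: ym2; rewrite mulrS; lra.
      by move: ym1; lra.
    by rewrite ler_norml => /andP[]; lra.
  case: ifPn => [/eqP->|_]; last exact: xab.
  by apply/andP; split; move: ym1 ym2; lra.
apply/lee_addgt0Pr => eps eps0.
pose K := 2 * `|t| * h * h * Q.
have K0 : 0 <= K by rewrite /K !mulr_ge0.
(* With K / eps < N + 1 the excess volume K / (N + 1) is at most eps. *)
apply: (le_trans (slabs (Num.truncn (K / eps)))).
rewrite -EFinD lee_fin lerD2l -/K ler_pdivrMr ?ltr0Sn// -ler_pdivrMl//.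
by rewrite mulrC ltW// truncnS_gt.
Qed.

(** * Volume of the ball *)

(* Integrating the weighted covering inequality one coordinate at a time. *)
Lemma weighted_cover_vol (R : realType) (del : R) (L : nat) (C : R)
    (w : nat -> R) (a b : nat -> 'I_L -> R) :
  0 <= del -> 0 <= C -> (forall n, 0 <= w n) -> (forall n i, a n i <= b n i) ->
  (forall x : 'I_L -> R, (forall i, 0 <= x i <= del) ->
    (C%:E <= \sum_(0 <= n <oo)
       (w n * \prod_(i < L) \1_(`[a n i, b n i]%classic) (x i))%:E)%E) ->
  ((C * del ^+ L)%:E <= \sum_(0 <= n <oo) (w n * boxvol (a n) (b n))%:E)%E.
Proof.
move=> del0; elim: L C w a b => [|L IH] C w a b C0 w0 ab cov.
  (* ['I_0] is empty, so the coordinate bounds required by [cov] hold vacuously. *)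
  have := cov (fun=> 0) (fun i => False_ind _ (match i with Ordinal _ p => notF p end)).
  rewrite expr0 mulr1 => /le_trans; apply.
  by apply: lee_nneseries => n *; rewrite /boxvol !big_ord0 ?mulr1 ?lee_fin.
pose a' n i := a n (lift ord0 i); pose b' n i := b n (lift ord0 i).
pose I n := `[a n ord0, b n ord0]%classic.
have v0 n : 0 <= boxvol (a' n) (b' n) by apply: boxvol_ge0 => i; exact: ab.
(* Freezing coordinate 0 at x0 turns the indicator of its interval into part of the weight, and the
   induction hypothesis applies to the remaining coordinates. *)
have slice (x0 : R) : 0 <= x0 <= del -> ((C * del ^+ L)%:E <=
    \sum_(0 <= n <oo) ((w n * boxvol (a' n) (b' n))%:E * (\1_(I n) x0)%:E))%E.
  move=> x0del.
  have -> : (\sum_(0 <= n <oo) ((w n * boxvol (a' n) (b' n))%:E * (\1_(I n) x0)%:E) =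
    \sum_(0 <= n <oo) ((w n * \1_(I n) x0) * boxvol (a' n) (b' n))%:E)%E.
    by apply: eq_eseriesr => n _; rewrite -EFinM mulrAC.
  apply: IH => //.
  - by move=> n; rewrite mulr_ge0.
  - by move=> n i; exact: ab.
  move=> y ydel.
  have := cov (fun i => oapp y x0 (unlift ord0 i)).
  move=> /(_ _)/le_trans; apply.
    by move=> i; case: unliftP => [j _|_] //=; exact: ydel.
  apply: lee_nneseries => n.
    by move=> _; rewrite lee_fin mulr_ge0// prodr_ge0.
  move=> _; rewrite lee_fin big_ord_recl unlift_none /= -mulrA.
  rewrite ler_wpM2l// ler_wpM2l//.
  by under eq_bigr do rewrite liftK.
(* Integrating over x0 in [0, del] gives the missing factor del on the left and, on the right, at
   most the length of the 0-th side in each term. *)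
have : (\int[lebesgue_measure]_(x in `[0%R, del]) cst (C * del ^+ L)%:E x <=
  \int[lebesgue_measure]_(x in `[0%R, del])
    \sum_(0 <= n <oo) ((w n * boxvol (a' n) (b' n))%:E * (\1_(I n) x)%:E))%E.
  apply: ge0_le_integral => //.
  - by move=> x _; rewrite lee_fin mulr_ge0// exprn_ge0.
  - apply: ge0_emeasurable_sum => n.
      by move=> x _ _; rewrite -EFinM lee_fin !mulr_ge0.
    move=> _; apply: emeasurable_funM => //; apply/measurable_EFinP.
    by apply: measurable_indic; exact: measurable_itv.
rewrite integral_cst//= lebesgue_measure_itv /= lte_fin.
have -> : (if 0 < del then (del%:E - 0)%E else 0%E) = del%:E :> \bar R.
  case: ltP => [_|d0]; first by rewrite sube0.
  by congr EFin; apply/eqP; rewrite eq_le d0 del0.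
rewrite -EFinM -mulrA -exprSr => /le_trans; apply.
rewrite integral_nneseries//; last 2 first.
- move=> n; apply: emeasurable_funM => //; apply/measurable_EFinP.
  by apply: measurable_indic; exact: measurable_itv.
- by move=> n x _; rewrite -EFinM lee_fin !mulr_ge0.
apply: lee_nneseries => n.
  by move=> _ _; apply: integral_ge0 => x _; rewrite -EFinM lee_fin !mulr_ge0.
move=> _.
rewrite ge0_integralZl_EFin//; last 2 first.
- by apply/measurable_EFinP; apply: measurable_indic; exact: measurable_itv.
- by rewrite mulr_ge0.
rewrite integral_indic//; last exact: measurable_itv.
rewrite /boxvol big_ord_recl.
apply: le_trans (_ : (_ <= (w n * boxvol (a' n) (b' n))%:E *
   (b n ord0 - a n ord0)%:E)%E) _.
  apply: lee_wpmul2l; first by rewrite lee_fin; apply: mulr_ge0; [exact: w0|exact: v0].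
  apply: (@le_trans _ _ (lebesgue_measure (I n))).
    apply: le_measure; rewrite ?inE//; last exact: measurable_itv.
    by apply: measurableI; exact: measurable_itv.
  rewrite /= lebesgue_measure_itv /= lte_fin; case: ifPn => //.
  by rewrite lee_fin subr_ge0.
by rewrite -EFinM lee_fin -mulrA ler_wpM2l// mulrC.
Qed.

(** The ball contains the cube [0, 1/L]^L, since L (1/L)^2 = 1/L <= 1, and every countable cover of
    this cube has total volume at least L^(-L). *)
Lemma lebRn_ball1_gt0 (R : realType) (L : nat) : (0 < L)%N ->
  (0 < lebRn (@ball1 R L))%E.
Proof.
move=> L0.
have L0' : 0 < L%:R :> R by rewrite ltr0n.
pose del : R := L%:R^-1.
have del0 : 0 < del by rewrite invr_gt0.
apply: (@lt_le_trans _ _ (del ^+ L)%:E); first by rewrite lte_fin exprn_gt0.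
apply/le_ereal_inf_tmp => _ [a [b [ab cov ->]]].
rewrite -[del ^+ L]mul1r.
apply: le_trans (weighted_cover_vol (w := fun=> 1) (ltW del0) ler01 _ ab _) _ => //.
  move=> x xdel.
  have /cov[n _ xn] : ball1 x.
    rewrite /ball1 /= /rnorm -[leRHS]sqrtr1 ler_sqrt//.
    apply: (@le_trans _ _ (\sum_(i < L) del ^+ 2)).
      by apply: ler_sum => i _; have /andP[x0 x1] := xdel i; rewrite lerXn2r ?nnegrE// ltW.
    rewrite sumr_const card_ord -mulr_natr /del expr2 mulfVK ?gt_eqF//.
    by rewrite invf_le1// ler1n.
  (* A box containing x contributes the value 1, already present in the partial sum up to its index
     n. *)
  apply: le_trans (nneseries_lim_ge n.+1 _); last first.
    by move=> k _ _; rewrite lee_fin mul1r prodr_ge0.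
  rewrite big_nat_recr//= -[leLHS]add0e; apply: leeD.
    by apply: sume_ge0 => k _; rewrite lee_fin mul1r prodr_ge0.
  rewrite lee_fin mul1r big1// => i _.
  by rewrite indicE mem_set//= in_itv/= xn.
by under eq_eseriesr do rewrite mul1r.
Qed.

Lemma lebRn_ball1_fin_num (R : realType) (L : nat) : (0 < L)%N ->
  lebRn (@ball1 R L) \is a fin_num.
Proof.
move=> L0; rewrite ge0_fin_numE ?lebRn_ge0//.
apply: le_lt_trans (ltry (boxvol (fun _ : 'I_L => -1) (fun=> 1) : R)).
apply: le_trans (lebRn_box L0 _); last by move=> _; lra.
apply: le_lebRn => x; rewrite /ball1 /rnorm /= -[leRHS]sqrtr1 ler_sqrt// => x1 i.
rewrite -ler_norml -(@ler_pXn2r _ 2%N) ?nnegrE// expr1n real_normK ?num_real//.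
by apply: le_trans x1; rewrite (bigD1 i)//= lerDl sumr_ge0// => j _; rewrite sqr_ge0.
Qed.

Lemma lebRn_set0 (R : realType) (L : nat) : (0 < L)%N ->
  lebRn (@set0 ('I_L -> R)) = 0%E.
Proof.
move=> L0; apply/eqP; rewrite eq_le lebRn_ge0 andbT.
apply: le_trans (_ : (_ <= lebRn (box (fun _ : 'I_L => 0%R) (fun _ => 0%R)))%E) _.
  exact: le_lebRn.
apply: (le_trans (lebRn_box L0 _)) => //.
by rewrite /boxvol (bigD1 (Ordinal L0))//= subrr mul0r.
Qed.

(** * Invariance of the uniform distribution *)

Definition givens (R : realType) (L : nat) (i j : 'I_L) (c s : R)
    (x : 'I_L -> R) : 'I_L -> R :=
  fun l => if l == i then c * x i - s * x j
           else if l == j then s * x i + c * x j else x l.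

(** For c = cos theta and s = sin theta the outer shears have parameter (c - 1) / s = - tan (theta /
    2). *)
Lemma givens_shear (R : realType) (L : nat) (i j : 'I_L) (c s : R)
    (x : 'I_L -> R) : i != j -> s != 0 -> c ^+ 2 + s ^+ 2 = 1 ->
  givens i j c s x =
  shear i j ((c - 1) / s) (shear j i s (shear i j ((c - 1) / s) x)).
Proof.
move=> ij s0 cs; have ji : (j == i) = false by rewrite eq_sym (negPf ij).
have cc : (c - 1) * (1 + c) = - s ^+ 2 by rewrite (_ : _ * _ = c ^+ 2 - 1); [lra | ring].
apply/funext => l; rewrite /givens /shear !eqxx ji (negPf ij).
have [_|li] := eqVneq l i.
  rewrite (_ : - (s * x j) = (c - 1) * (1 + c) / s * x j); last by rewrite cc; field.
  by field.
by case: eqP => // _; field.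
Qed.

Lemma lebRn_givens (R : realType) (L : nat) (i j : 'I_L) (c s : R)
    (E : set ('I_L -> R)) : i != j -> s != 0 -> c ^+ 2 + s ^+ 2 = 1 ->
  (lebRn (givens i j c s @` E) <= lebRn E)%E.
Proof.
move=> ij s0 cs; set t := (c - 1) / s.
have -> : givens i j c s @` E =
    shear i j t @` (shear j i s @` (shear i j t @` E)).
  rewrite !image_comp; apply: eq_imagel => x _ /=; exact: givens_shear.
apply: (le_trans (lebRn_shear _ _ ij)).
apply: le_trans (lebRn_shear _ _ ij).
by apply: lebRn_shear; rewrite eq_sym.
Qed.

Lemma givensK (R : realType) (L : nat) (i j : 'I_L) (c s : R) :
  i != j -> c ^+ 2 + s ^+ 2 = 1 ->
  cancel (@givens R L i j c s) (givens i j c (- s)).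
Proof.
move=> ij cs x; have ji : (j == i) = false by rewrite eq_sym (negPf ij).
apply/funext => l; rewrite /givens eqxx ji eqxx.
have [->|li] := eqVneq l i.
  by rewrite -[RHS]mul1r -cs; ring.
have [->|lj] // := eqVneq l j.
by rewrite -[RHS]mul1r -cs; ring.
Qed.

Lemma flipK (R : realType) (L : nat) (e : pred 'I_L) : involutive (@flip R L e).
Proof.
by move=> x; apply/funext => l; rewrite /flip; case: (e l); rewrite ?opprK.
Qed.

Definition dot (R : realType) (L : nat) (v x : 'I_L -> R) : R :=
  \sum_(l < L) v l * x l.

(** The adjoint of a rotation is the rotation by the opposite angle. This gives invariance of the
    norm and moves rotations from the random vector to the argument of its moment generating
    function. *)
Lemma dot_givens (R : realType) (L : nat) (i j : 'I_L) (c s : R)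
    (v x : 'I_L -> R) : i != j ->
  dot v (givens i j c s x) = dot (givens i j c (- s) v) x.
Proof.
move=> ij; have ji : (j == i) = false by rewrite eq_sym (negPf ij).
rewrite /dot (bigD1 i)//= [RHS](bigD1 i)//= (bigD1 j) ?ji//= [in RHS](bigD1 j) ?ji//=.
rewrite !addrA; congr (_ + _).
  by rewrite /givens !eqxx ji; ring.
by apply: eq_bigr => l /andP[li lj]; rewrite /givens (negPf li) (negPf lj).
Qed.

Lemma dot_flip (R : realType) (L : nat) (e : pred 'I_L) (v x : 'I_L -> R) :
  dot v (flip e x) = dot (flip e v) x.
Proof.
by apply: eq_bigr => l _; rewrite /flip; case: (e l); rewrite ?mulrN ?mulNr.
Qed.

Lemma rnorm_dot (R : realType) (L : nat) (x : 'I_L -> R) :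
  rnorm x = Num.sqrt (dot x x).
Proof. by []. Qed.

Lemma rnorm_givens (R : realType) (L : nat) (i j : 'I_L) (c s : R)
    (x : 'I_L -> R) : i != j -> c ^+ 2 + s ^+ 2 = 1 ->
  rnorm (givens i j c s x) = rnorm x.
Proof. by move=> ij cs; rewrite !rnorm_dot dot_givens// givensK. Qed.

Lemma rnorm_flip (R : realType) (L : nat) (e : pred 'I_L) (x : 'I_L -> R) :
  rnorm (flip e x) = rnorm x.
Proof. by rewrite !rnorm_dot dot_flip flipK. Qed.

(** The generators of [borelRn] under a name, so that [g_sigma_algebraType] makes R^L a measurable
    type. *)
Definition coord_gen (R : realType) (L : nat) : set (set ('I_L -> R)) :=
  [set (fun v : 'I_L -> R => v i) @^-1` B |
    i in [set: 'I_L] & B in [set B : set R | measurable B]].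

Lemma measurable_coord (R : realType) (L : nat) (i : 'I_L) :
  measurable_fun setT (fun x : g_sigma_algebraType (@coord_gen R L) => x i).
Proof.
move=> _ Y mY; rewrite setTI; apply: sub_sigma_algebra.
by exists i => //; exists Y.
Qed.

Lemma borelRn_dot (R : realType) (L : nat) (v : 'I_L -> R) (A : set R) :
  measurable A -> borelRn [set x | A (dot v x)].
Proof.
move=> mA.
have mdot : measurable_fun setT
    (fun x : g_sigma_algebraType (@coord_gen R L) => dot v x).
  apply: measurable_sum => l; apply: measurable_funM => //.
  exact: measurable_coord.
by have := mdot measurableT A mA; rewrite setTI.
Qed.

Lemma sphereE (R : realType) (L : nat) :
  @sphere R L = [set x | \sum_(i < L) x i ^+ 2 = 1].
Proof.
have S0 (x : 'I_L -> R) : 0 <= \sum_(i < L) x i ^+ 2.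
  by apply: sumr_ge0 => i _; exact: sqr_ge0.
apply/seteqP; split => x; rewrite /sphere /rnorm /= => x1; last by rewrite x1 sqrtr1.
by rewrite -[LHS]sqr_sqrtr// x1 expr1n.
Qed.

Lemma borelRn_sphere (R : realType) (L : nat) : borelRn (@sphere R L).
Proof.
have mnorm : measurable_fun setT
    (fun x : g_sigma_algebraType (@coord_gen R L) => \sum_(i < L) x i ^+ 2).
  apply: measurable_sum => l; apply: measurable_funX.
  exact: measurable_coord.
by have := mnorm measurableT [set 1] (measurable_set1 1); rewrite setTI sphereE.
Qed.

Lemma measurable_preimage_borelRn d (T : measurableType d) (R : realType)
    (L : nat) (X : T -> 'I_L -> R) (B : set ('I_L -> R)) :
  (forall i, measurable_fun setT (fun w => X w i)) -> borelRn B ->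
  measurable (X @^-1` B).
Proof.
move=> mX; apply: (@smallest_sub _ (sigma_algebra setT) (coord_gen (R := R) (L := L))
  [set B | measurable (X @^-1` B)]).
  split => [|A mA|A mA] /=.
  - by rewrite preimage_set0.
  - by rewrite setTD preimage_setC; exact: measurableC.
  - by rewrite preimage_bigcup; exact: bigcupT_measurable.
by move=> _ [i _ [Y mY <-]] /=; have := mX i measurableT Y mY; rewrite setTI.
Qed.

(** T maps the cone over the preimage of B onto the cone over B, and S maps it back. Neither
    increases [lebRn], so the two cones have equal volume; the volume of the ball, positive and
    finite, then cancels. *)
Lemma uniform_preimage d (Omega : measurableType d) (R : realType)
    (P : probability Omega R) (L : nat) (X : Omega -> 'I_L -> R)
    (T S : ('I_L -> R) -> 'I_L -> R) (B : set ('I_L -> R)) :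
  (0 < L)%N -> uniform_on_sphere P X ->
  (forall i, measurable_fun setT (fun w => X w i)) ->
  cancel T S -> cancel S T ->
  (forall t x, T (fun l => t * x l) = (fun l => t * T x l)) ->
  (forall x, rnorm (T x) = rnorm x) ->
  (forall E, lebRn (T @` E) <= lebRn E)%E ->
  (forall E, lebRn (S @` E) <= lebRn E)%E ->
  borelRn B -> borelRn (T @^-1` B) ->
  P (X @^-1` (T @^-1` B)) = P (X @^-1` B).
Proof.
move=> L0 uX mX TK SK Tlin Tnorm Tleb Sleb mB mTB.
have coneT : T @` cone (T @^-1` B `&` @sphere R L) = cone (B `&` @sphere R L).
  apply/seteqP; split => [_ [_ [t [x [t01 [Bx x1] ->]]] <-]|_ [t [x [t01 [Bx x1] ->]]]].
    by exists t, (T x); split => //; split => //; rewrite /sphere /= Tnorm.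
  exists (S (fun l => t * x l)); last exact: SK.
  have Slin : S (fun l => t * x l) = (fun l => t * S x l).
    by apply: (can_inj TK); rewrite Tlin !SK.
  exists t, (S x); split => //; split; first by rewrite /preimage /= SK.
  by rewrite /sphere /= -Tnorm SK.
have coneS : S @` cone (B `&` @sphere R L) = cone (T @^-1` B `&` @sphere R L).
  rewrite -coneT image_comp; apply/seteqP; split => [_ [x Cx <-]|x Cx] /=.
    by rewrite TK.
  by exists x => //=; rewrite TK.
have leb_eq : lebRn (cone (T @^-1` B `&` @sphere R L)) = lebRn (cone (B `&` @sphere R L)).
  by apply/eqP; rewrite eq_le -{1}coneS Sleb -coneT Tleb.
have := uX _ mTB; rewrite leb_eq -(uX _ mB).
have c0 := lebRn_ball1_gt0 R L0.
rewrite -(fineK (lebRn_ball1_fin_num R L0)).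
have fP C : borelRn C -> exists r, P (X @^-1` C) = r%:E.
  move=> mC; exists (fine (P (X @^-1` C))); rewrite fineK// fin_num_measure//.
  exact: measurable_preimage_borelRn.
have [[r1 ->] [r2 ->]] := (fP _ mTB, fP _ mB).
rewrite -!EFinM => -[] /mulIf -> //.
by rewrite gt_eqF// fine_gt0// c0 ltey_eq lebRn_ball1_fin_num.
Qed.

(** The cone over the part of the complement of the sphere that lies on the sphere is empty, so its
    volume is zero, whereas the ball has positive volume. *)
Lemma uniform_sphere_ae d (Omega : measurableType d) (R : realType)
    (P : probability Omega R) (L : nat) (X : Omega -> 'I_L -> R) :
  (0 < L)%N -> (forall i, measurable_fun setT (fun w => X w i)) ->
  uniform_on_sphere P X -> {ae P, forall w, \sum_(i < L) X w i ^+ 2 = 1}.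
Proof.
move=> L0 mX uX.
have mC : borelRn (~` @sphere R L).
  have mS : (@measurable _ (g_sigma_algebraType (@coord_gen R L))) (@sphere R L).
    exact: borelRn_sphere.
  exact: measurableC mS.
exists (X @^-1` (~` @sphere R L)); split.
- exact: measurable_preimage_borelRn.
- have := uX _ mC; rewrite setICl (_ : cone set0 = set0); last first.
    by apply/seteqP; split => // x [t [y []]].
  rewrite lebRn_set0// => /eqP; rewrite mule_eq0.
  by rewrite (gt_eqF (lebRn_ball1_gt0 R L0)) orbF => /eqP.
- by move=> w /=; apply: contra_not; rewrite sphereE.
Qed.

(** * Moment generating function of the uniform distribution *)

(** In the sum of the two series odd terms cancel and even terms double, and x^(2m) / (2m)! <= (x^2
    / 2)^m / m!. There are [uphalf n] even indices below n. *)
Lemma series_cosh_le (R : realType) (x : R) (n : nat) :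
  series (exp_coeff x) n + series (exp_coeff (- x)) n <=
  2 * series (exp_coeff (x ^+ 2 / 2)) (uphalf n).
Proof.
rewrite /series /=; elim: n => [|n IH]; first by rewrite !big_nil mulr0 addr0.
have -> : uphalf n.+1 = n./2.+1 by [].
rewrite !(big_nat_recr n)//= addrACA.
have [on|en] := boolP (odd n).
  have -> : exp_coeff x n + exp_coeff (- x) n = 0.
    by rewrite /exp_coeff /= exprNn -signr_odd on expr1 mulN1r mulNr subrr.
  by move: IH; rewrite addr0 uphalf_half on add1n.
have n2 : n = n./2.*2 by rewrite -[LHS]odd_double_half (negPf en).
rewrite big_nat_recr//= mulrDr; apply: lerD.
  by move: IH; rewrite uphalf_half (negPf en).
rewrite /exp_coeff /= exprNn -signr_odd (negPf en) mul1r -mulr2n -[leLHS]mulr_natl.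
rewrite ler_wpM2l//.
set m := n./2; rewrite n2 -/m -mul2n exprM expr_div_n -mulrA.
apply: ler_wpM2l; first by apply: exprn_ge0; exact: sqr_ge0.
rewrite -invfM lef_pV2 ?posrE ?mulr_gt0 ?exprn_gt0 ?ltr0n ?fact_gt0//.
rewrite -natrX -natrM ler_nat.
(* What remains is 2^m m! <= (2m)!. *)
elim: m => // m IHm; rewrite mulnS addSn expnS !factS.
apply: (@leq_trans ((2 * m.+1) * (2 ^ m * m`!))).
  by rewrite mulnACA.
apply: leq_mul; first by rewrite mulnS.
by apply: (leq_trans IHm); rewrite ?add0n leq_pmull.
Qed.

Lemma cosh_le_expR_sqr (R : realType) (x : R) :
  expR x + expR (- x) <= 2 * expR (x ^+ 2 / 2).
Proof.
rewrite /expR -limD; try exact: is_cvg_series_exp_coeff.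
apply: limr_le; first by apply: is_cvgD; exact: is_cvg_series_exp_coeff.
apply: nearW => n; apply: (le_trans (series_cosh_le x n)).
rewrite ler_pM2l//; apply: nondecreasing_cvgn_le; last exact: is_cvg_series_exp_coeff.
apply/nondecreasing_seqP => k; rewrite /series /= big_nat_recr//= lerDl.
by rewrite /exp_coeff /= divr_ge0// exprn_ge0// divr_ge0// sqr_ge0.
Qed.

(** Expanding the product chooses one of two exponentials for each coordinate, which amounts to
    choosing a sign pattern e. *)
Lemma sum_flip_expR (R : realType) (L : nat) (v x : 'I_L -> R) :
  \sum_(e : {ffun 'I_L -> bool}) expR (dot (flip e v) x) =
  \prod_(l < L) (expR (v l * x l) + expR (- (v l * x l))).
Proof.
transitivity (\prod_(l < L) \sum_(b : bool) expR ((if b then - v l else v l) * x l)).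
  rewrite bigA_distr_bigA; apply: eq_bigr => e _.
  by rewrite /dot expR_sum.
by apply: eq_bigr => l _; rewrite big_bool /= mulNr addrC.
Qed.

(** Both integrals are integrals of [expR] against the law on R, and the two laws agree. *)
Lemma integral_expR_law d (Omega : measurableType d) (R : realType)
    (P : probability Omega R) (f g : Omega -> R) :
  measurable_fun setT f -> measurable_fun setT g ->
  (forall A, measurable A -> P (f @^-1` A) = P (g @^-1` A)) ->
  (\int[P]_w (expR (f w))%:E = \int[P]_w (expR (g w))%:E)%E.
Proof.
move=> mf mg fg.
have me : measurable_fun setT (fun x : R => (expR x)%:E).
  by apply/measurable_EFinP; exact: measurable_expR.
pose f' : {mfun Omega >-> R} := HB.pack f (isMeasurableFun.Build _ _ _ _ f mf).
pose g' : {mfun Omega >-> R} := HB.pack g (isMeasurableFun.Build _ _ _ _ g mg).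
have pE (h : {mfun Omega >-> R}) : (\int[P]_w (expR (h w))%:E =
    \int[distribution P h]_x (expR x)%:E)%E.
  by rewrite /distribution ge0_integral_pushforward.
rewrite (pE f') (pE g'); apply: eq_measure_integral => A mA _.
exact: fg.
Qed.

Definition mgf d (Omega : measurableType d) (R : realType)
    (P : probability Omega R) (L : nat) (X : Omega -> 'I_L -> R)
    (v : 'I_L -> R) : \bar R := (\int[P]_w (expR (dot v (X w)))%:E)%E.

Lemma measurable_dot d (T : measurableType d) (R : realType) (L : nat)
    (v : 'I_L -> R) (X : T -> 'I_L -> R) :
  (forall i, measurable_fun setT (fun w => X w i)) ->
  measurable_fun setT (fun w => dot v (X w)).
Proof. by move=> mX; apply: measurable_sum => l; exact: measurable_funM. Qed.

Section uniform_mgf.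
Context d (Omega : measurableType d) (R : realType) (P : probability Omega R)
  (L : nat) (X : Omega -> 'I_L -> R).

Lemma mgf_flip (e : pred 'I_L) (v : 'I_L -> R) : (0 < L)%N ->
  (forall i, measurable_fun setT (fun w => X w i)) -> uniform_on_sphere P X ->
  mgf P X (flip e v) = mgf P X v.
Proof.
move=> L0 mX uX; apply: integral_expR_law; try exact: measurable_dot.
move=> A mA.
have := @uniform_preimage _ _ _ P L X (flip e) (flip e) [set x | A (dot v x)]
  L0 uX mX (@flipK _ _ _) (@flipK _ _ _).
have -> : flip e @^-1` [set x | A (dot v x)] = [set x | A (dot (flip e v) x)].
  by apply/seteqP; split => x; rewrite /preimage /= dot_flip.
apply; try exact: borelRn_dot.
- by move=> t x; apply/funext => l; rewrite /flip; case: ifP; rewrite ?mulrN.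
- by move=> x; exact: rnorm_flip.
- by move=> E; exact: lebRn_flip.
- by move=> E; exact: lebRn_flip.
Qed.

Lemma mgf_givens (i j : 'I_L) (c s : R) (v : 'I_L -> R) :
  (forall i, measurable_fun setT (fun w => X w i)) -> uniform_on_sphere P X ->
  i != j -> s != 0 -> c ^+ 2 + s ^+ 2 = 1 ->
  mgf P X (givens i j c s v) = mgf P X v.
Proof.
move=> mX uX ij s0 cs; apply: integral_expR_law; try exact: measurable_dot.
move=> A mA.
have L0 : (0 < L)%N by apply: leq_ltn_trans (ltn_ord i).
have csN : c ^+ 2 + (- s) ^+ 2 = 1 by rewrite sqrrN.
have := @uniform_preimage _ _ _ P L X (givens i j c (- s)) (givens i j c s)
  [set x | A (dot v x)] L0 uX mX.
have -> : givens i j c (- s) @^-1` [set x | A (dot v x)] =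
    [set x | A (dot (givens i j c s v) x)].
  by apply/seteqP; split => x; rewrite /preimage /= dot_givens// opprK.
apply; try exact: borelRn_dot.
- by rewrite -[in givens i j c s](opprK s); exact: givensK.
- exact: givensK.
- move=> t x; apply/funext => l; rewrite /givens; case: ifP => _; first by ring.
  by case: ifP => _ //; ring.
- by move=> x; exact: rnorm_givens.
- by move=> E; apply: lebRn_givens; rewrite ?oppr_eq0.
- by move=> E; exact: lebRn_givens.
Qed.

(* Rotating in the plane of a coordinate smaller and one larger than rho in
   absolute value turns the former into rho. *)
Lemma mgf_equalize (rho : R) (v : 'I_L -> R) :
  (forall i, measurable_fun setT (fun w => X w i)) -> uniform_on_sphere P X ->
  \sum_(l < L) (v l ^+ 2 - rho ^+ 2) = 0 ->
  exists2 v' : 'I_L -> R, (forall l, v' l ^+ 2 = rho ^+ 2) &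
    mgf P X v' = mgf P X v.
Proof.
(* Induction on the number of coordinates whose square differs from rho^2. *)
move=> mX uX; have [n] := ubnP #|[pred l | v l ^+ 2 != rho ^+ 2]|.
elim: n v => // n IH v ltn sum0.
have [/forallP allE|/forallPn[l0 vl0]] := boolP [forall l, v l ^+ 2 == rho ^+ 2].
  by exists v => // l; apply/eqP.
(* The deviations v_l^2 - rho^2 sum to zero and do not all vanish, so one of them is negative and
   one is positive. *)
have [i vi] : exists i, v i ^+ 2 < rho ^+ 2.
  apply: contrapT => /forallNP h; move: vl0; apply/negP; rewrite negbK -subr_eq0.
  apply/eqP; apply: (psumr_eq0P _ sum0) => // l _.
  by rewrite subr_ge0 leNgt; apply/negP; exact: h.
have [j vj] : exists j, rho ^+ 2 < v j ^+ 2.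
  apply: contrapT => /forallNP h; move: vl0; apply/negP; rewrite negbK eq_sym -subr_eq0.
  apply/eqP; apply: (@psumr_eq0P _ _ xpredT (fun l => rho ^+ 2 - v l ^+ 2)) => // [l _|].
    by rewrite subr_ge0 leNgt; apply/negP; exact: h.
  apply/eqP; rewrite -oppr_eq0 -sumrN -[X in _ == X]sum0.
  by apply/eqP; apply: eq_bigr => l _; rewrite opprB.
have ij : i != j by apply: contraTneq vi => ->; rewrite -leNgt ltW.
pose q := v i ^+ 2 + v j ^+ 2.
have q0 : 0 < q by rewrite /q; have := sqr_ge0 (v i); have := sqr_ge0 rho; lra.
(* The rotation is to send (v_i, v_j) to (rho, be), with be fixed by preservation of the norm.
   Solving c v_i - s v_j = rho and s v_i + c v_j = be gives c and s. *)
pose be := Num.sqrt (q - rho ^+ 2).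
have be2 : be ^+ 2 = q - rho ^+ 2.
  by rewrite sqr_sqrtr// /q; have := sqr_ge0 (v i); lra.
pose c := (rho * v i + be * v j) / q.
pose s := (be * v i - rho * v j) / q.
have cs : c ^+ 2 + s ^+ 2 = 1.
  have -> : c ^+ 2 + s ^+ 2 = (rho ^+ 2 + be ^+ 2) * (v i ^+ 2 + v j ^+ 2) / q ^+ 2.
    by rewrite /c /s; field; rewrite gt_eqF.
  by rewrite be2 addrC subrK -/q -expr2 divff// expf_neq0// gt_eqF.
(* If s = 0, squaring be v_i = rho v_j gives (v_i^2 - rho^2) q = 0, against v_i^2 < rho^2. *)
have s0 : s != 0.
  apply/negP; rewrite /s mulf_eq0 invr_eq0 (gt_eqF q0) orbF subr_eq0 => /eqP e.
  have : (v i ^+ 2 - rho ^+ 2) * q = 0.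
    have : (be * v i) ^+ 2 = (rho * v j) ^+ 2 by rewrite e.
    by rewrite !exprMn be2 /q => ?; lra.
  by move/eqP; rewrite mulf_eq0 (gt_eqF q0) orbF subr_eq0 (lt_eqF vi).
pose v1 := givens i j c s v.
have v1i : v1 i = rho.
  rewrite /v1 /givens eqxx /c /s.
  rewrite (_ : _ - _ = rho * (v i ^+ 2 + v j ^+ 2) / q); last by field; rewrite gt_eqF.
  by rewrite -/q mulfK// gt_eqF.
have v1l l : l != i -> l != j -> v1 l = v l.
  by move=> li lj; rewrite /v1 /givens (negPf li) (negPf lj).
have [||v' v'E vE] := IH v1.
(* Coordinate i leaves the set of wrong coordinates; coordinate j belonged to it before, so nothing
   new enters. *)
- rewrite -ltnS; apply: leq_trans ltn; rewrite ltnS; apply: proper_card.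
  apply/properP; split.
    apply/fintype.subsetP => l; rewrite !inE.
    have [->|li] := eqVneq l i; first by rewrite v1i eqxx.
    have [->|lj] := eqVneq l j; first by rewrite (gt_eqF vj).
    by rewrite v1l.
  by exists i; rewrite !inE ?v1i ?eqxx// lt_eqF.
- rewrite -[RHS]sum0 !sumrB; congr (_ - _).
  have /(congr1 (fun x => x ^+ 2)) := rnorm_givens v ij cs.
  rewrite /rnorm -/v1 !sqr_sqrtr//; by apply: sumr_ge0 => l _; exact: sqr_ge0.
- by exists v' => //; rewrite vE; exact: mgf_givens.
Qed.

Lemma uniform_mgf_le (v : 'I_L -> R) : (0 < L)%N ->
  (forall i, measurable_fun setT (fun w => X w i)) -> uniform_on_sphere P X ->
  (mgf P X v <= (expR ((\sum_(l < L) v l ^+ 2) / (2 * L%:R)))%:E)%E.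
Proof.
move=> L0 mX uX.
have L0' : 0 < L%:R :> R by rewrite ltr0n.
pose rho := Num.sqrt ((\sum_(l < L) v l ^+ 2) / L%:R).
have rho2 : rho ^+ 2 = (\sum_(l < L) v l ^+ 2) / L%:R.
  by rewrite sqr_sqrtr// divr_ge0// sumr_ge0// => l _; exact: sqr_ge0.
have [|v' v'E <-] := @mgf_equalize rho v mX uX.
  by rewrite sumrB sumr_const card_ord -mulr_natr rho2 divfK ?subrr// gt_eqF.
have -> : (\sum_(l < L) v l ^+ 2) / (2 * L%:R) = rho ^+ 2 / 2.
  by rewrite rho2; field; rewrite gt_eqF.
pose K : R := 2 ^+ L.
have K0 : 0 < K by rewrite exprn_gt0.
have mexp u : measurable_fun setT (fun w => (expR (dot u (X w)))%:E).
  by apply/measurable_EFinP/measurableT_comp => //; exact: measurable_dot.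
rewrite -(@lee_pmul2l _ K%:E)//.
(* Each of the 2^L sign patterns gives the same moment generating function, so K times its value is
   the integral of the sum over all patterns. *)
have -> : (K%:E * mgf P X v' =
    \int[P]_w (\sum_(e : {ffun 'I_L -> bool}) expR (dot (flip e v') (X w)))%:E)%E.
  under eq_integral do rewrite -sumEFin.
  rewrite ge0_integral_sum//.
  under eq_bigr do rewrite -/(mgf P X _) mgf_flip//.
  rewrite big_const card_ffun card_bool card_ord /K -natrX.
  elim: (2 ^ L)%N => [|n IH]; first by rewrite mul0e.
  by rewrite iterS -IH -nat1r EFinD ge0_muleDl ?lee_fin// mul1e.
apply: (@le_trans _ _ (\int[P]_w (cst (K * expR (rho ^+ 2 / 2))%:E w))%E); last first.
  by rewrite integral_cst//= probability_setT mule1 EFinM.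
apply: ae_ge0_le_integral => //.
- by move=> w _; rewrite lee_fin sumr_ge0// => e _; rewrite expR_ge0.
- apply/measurable_EFinP; apply: measurable_sum => e.
  by apply: measurableT_comp => //; exact: measurable_dot.
- by move=> w _; rewrite lee_fin mulr_ge0 ?expR_ge0// ltW.
(* Almost surely |X| = 1, and there the sum over signs is a product of factors 2 cosh, bounded one
   coordinate at a time. *)
apply: filterS (uniform_sphere_ae L0 mX uX) => w X1 _.
rewrite lee_fin sum_flip_expR.
apply: (@le_trans _ _ (\prod_(l < L) (2 * expR ((v' l * X w l) ^+ 2 / 2)))).
  apply: ler_prod => l _; rewrite cosh_le_expR_sqr andbT.
  by rewrite addr_ge0// expR_ge0.
rewrite big_split/= prodr_const card_ord -expR_sum.
have -> : \sum_(l < L) (v' l * X w l) ^+ 2 / 2 = rho ^+ 2 / 2 * \sum_(l < L) X w l ^+ 2.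
  by rewrite mulr_sumr; apply: eq_bigr => l _; rewrite exprMn v'E mulrAC.
by rewrite X1 mulr1.
Qed.

End uniform_mgf.

(** * Sums of independent vectors *)

(** As functions of A, both sides are finite measures that agree on a generating pi-system
    containing the whole space. *)
Lemma indep_sigma_algebra d (Omega : measurableType d) (R : realType)
    (P : probability Omega R) (G : set (set Omega)) (B : set Omega) :
  G `<=` measurable -> setI_closed G -> G setT -> measurable B ->
  (forall A, G A -> P (A `&` B) = (P A * P B)%E) ->
  forall A, <<s G >> A -> P (A `&` B) = (P A * P B)%E.
Proof.
move=> Gm GI GT mB GB A sA.
have fB : P B = (fine (P B))%:E by rewrite fineK// fin_num_measure.
have B0 : 0 <= fine (P B) by rewrite fine_ge0.
suff e : mrestr P mB A = mscale (NngNum B0) P A.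
  by rewrite -[LHS]/(mrestr P mB A) e /mscale/= -fB muleC.
apply: (g_sigma_algebra_measure_unique G Gm (fun=> setT)) => //.
- by rewrite bigcup_const//; exists 0%N.
- by move=> C GC; rewrite /= /mrestr /mscale/= GB// muleC -fB.
- by move=> _; rewrite /= /mrestr setTI (le_lt_trans (probability_le1 P mB))// ltry.
Qed.

Lemma measurable_id_g_sigma_algebra d (Omega : measurableType d)
    (G : set (set Omega)) : G `<=` measurable ->
  measurable_fun setT (idfun : Omega -> g_sigma_algebraType G).
Proof.
move=> Gm _ Y sY; rewrite setTI preimage_id.
by apply: (smallest_sub _ Gm) sY; exact: sigma_algebra_measurable.
Qed.

(** Under independence the law of the diagonal map w -> (w, w), with the sigma-algebra of G1 on the
    first copy and that of G2 on the second, is the product of the two restrictions of P. Tonelli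
    then gives the iterated integral. *)
Lemma indep_fubini d (Omega : measurableType d) (R : realType)
    (P : probability Omega R) (G1 G2 : set (set Omega))
    (f : g_sigma_algebraType G1 * g_sigma_algebraType G2 -> \bar R) :
  G1 `<=` measurable -> G2 `<=` measurable ->
  setI_closed G1 -> setI_closed G2 -> G1 setT -> G2 setT ->
  (forall A B, G1 A -> G2 B -> P (A `&` B) = (P A * P B)%E) ->
  measurable_fun setT f -> (forall x, 0 <= f x)%E ->
  (\int[P]_w f (w, w) = \int[P]_w \int[P]_w' f (w, w'))%E.
Proof.
move=> G1m G2m G1I G2I G1T G2T GP mf f0.
have m1 := measurable_id_g_sigma_algebra G1m.
have m2 := measurable_id_g_sigma_algebra G2m.
(* Independence passes from the generators to the generated sigma-algebras one side at a time. *)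
have indep A B : <<s G1 >> A -> <<s G2 >> B -> P (A `&` B) = (P A * P B)%E.
  move=> sA sB; rewrite setIC muleC.
  apply: (indep_sigma_algebra G2m) => //.
    by have := m1 measurableT A sA; rewrite setTI.
  move=> {sB}B GB; rewrite setIC muleC; apply: (indep_sigma_algebra G1m) => //.
    exact: G2m.
  by move=> {sA}A GA; exact: GP.
pose i1 : {mfun Omega >-> g_sigma_algebraType G1} :=
  HB.pack (idfun : Omega -> g_sigma_algebraType G1)
    (isMeasurableFun.Build _ _ _ _ (idfun : Omega -> g_sigma_algebraType G1) m1).
pose i2 : {mfun Omega >-> g_sigma_algebraType G2} :=
  HB.pack (idfun : Omega -> g_sigma_algebraType G2)
    (isMeasurableFun.Build _ _ _ _ (idfun : Omega -> g_sigma_algebraType G2) m2).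
pose D (w : Omega) : g_sigma_algebraType G1 * g_sigma_algebraType G2 := (i1 w, i2 w).
have mD : measurable_fun setT D by exact: measurable_fun_pair.
pose i12 : {mfun Omega >-> (g_sigma_algebraType G1 * g_sigma_algebraType G2)%type} :=
  HB.pack D (isMeasurableFun.Build _ _ _ _ D mD).
transitivity (\int[distribution P i12]_z f z)%E.
  by rewrite /distribution ge0_integral_pushforward.
transitivity (\int[distribution P i1 \x distribution P i2]_z f z)%E.
  apply: eq_measure_integral => A mA _.
  by apply/esym/product_measure_unique => // B C mB mC; exact: indep.
rewrite fubini_tonelli1//.
rewrite /distribution ge0_integral_pushforward//; last 2 first.
- exact: measurable_fun_fubini_tonelli_F.
- by move=> x _; apply: integral_ge0.
apply: eq_integral => w _; rewrite /fubini_F /=.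
rewrite ge0_integral_pushforward//.
by apply: measurableT_comp => //; exact: measurable_fun_pair.
Qed.

Lemma measurable_partial_integral d (Omega : measurableType d) (R : realType)
    (P : probability Omega R) (G1 G2 : set (set Omega))
    (f : g_sigma_algebraType G1 * g_sigma_algebraType G2 -> \bar R) :
  G1 `<=` measurable -> G2 `<=` measurable ->
  measurable_fun setT f -> (forall x, 0 <= f x)%E ->
  measurable_fun setT (fun w : Omega => \int[P]_w' f (w, w'))%E.
Proof.
move=> G1m G2m mf f0.
have m1 := measurable_id_g_sigma_algebra G1m.
have m2 := measurable_id_g_sigma_algebra G2m.
pose i2 : {mfun Omega >-> g_sigma_algebraType G2} :=
  HB.pack (idfun : Omega -> g_sigma_algebraType G2)
    (isMeasurableFun.Build _ _ _ _ (idfun : Omega -> g_sigma_algebraType G2) m2).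
have := measurableT_comp
  (@measurable_fun_fubini_tonelli_F _ _ _ _ _ (distribution P i2) f mf f0) m1.
apply: eq_measurable_fun => w _; rewrite /fubini_F /= /distribution.
rewrite ge0_integral_pushforward//.
by apply: measurableT_comp => //; exact: measurable_fun_pair.
Qed.

(** Measurability is asked only for indices in s because, for the sigma-algebra of the vectors other
    than [j0], it is available only when j differs from [j0]. *)
Lemma measurable_sum_in d (T : measurableType d) (R : realType) (I : eqType)
    (s : seq I) (h : I -> T -> R) :
  (forall j, j \in s -> measurable_fun setT (h j)) ->
  measurable_fun setT (fun w => \sum_(j <- s) h j w).
Proof.
elim: s => [|j s IH] mh; first
  by rewrite (_ : (fun w => _) = cst 0)//; apply/funext => w; rewrite big_nil.
rewrite (_ : (fun w => _) = h j \+ (fun w => \sum_(j <- s) h j w)); last first.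
  by apply/funext => w; rewrite big_cons.
apply: measurable_funD; first by apply: mh; rewrite mem_head.
by apply: IH => l ls; apply: mh; rewrite in_cons ls orbT.
Qed.

(** * Adding one independent vector to the sum *)

Section vector_sum.
Context d (Omega : measurableType d) (R : realType) (P : probability Omega R)
  (k L : nat) (al be : 'I_k -> R) (Z : 'I_k -> Omega -> 'I_L -> R).

(** The squared norm of the partial sum over s, where [al] and [be] stand for the real and imaginary
    parts of the complex coefficients. *)
Definition sqnorm_sum (s : seq 'I_k) (w : Omega) : R :=
  \sum_(l < L) ((\sum_(j <- s) al j * Z j w l) ^+ 2 +
                (\sum_(j <- s) be j * Z j w l) ^+ 2).

Definition sqnorm_coef (s : seq 'I_k) : R :=
  \sum_(j <- s) (al j ^+ 2 + be j ^+ 2).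

(** A pi-system for the vectors other than [Z j0]. Index [j0] is kept with the trivial constraint
    [setT], so that the sets have the form used in [indep_vectors]. *)
Definition others_gen (j0 : 'I_k) : set (set Omega) :=
  [set E | exists B : 'I_k -> set ('I_L -> R), [/\ forall j, borelRn (B j),
     B j0 = setT & E = \bigcap_(j in [set: 'I_k]) (Z j @^-1` B j)]].

Definition single_gen (j0 : 'I_k) : set (set Omega) :=
  [set E | exists2 B : set ('I_L -> R), borelRn B & E = Z j0 @^-1` B].

Lemma borelRnT : borelRn [set: 'I_L -> R].
Proof. exact: (@measurableT _ (g_sigma_algebraType (@coord_gen R L))). Qed.

Lemma borelRnI (A B : set ('I_L -> R)) : borelRn A -> borelRn B -> borelRn (A `&` B).
Proof. exact: (@measurableI _ (g_sigma_algebraType (@coord_gen R L))). Qed.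

Lemma others_gen_setI (j0 : 'I_k) : setI_closed (others_gen j0).
Proof.
move=> _ _ [A [mA A0 ->]] [B [mB B0 ->]]; exists (fun j => A j `&` B j); split.
- by move=> j; exact: borelRnI.
- by rewrite A0 B0 setIT.
- by apply/seteqP; split => [w [hA hB] j _|w h]; [split; [exact: hA|exact: hB]|
    split => j _; have [] := h j I].
Qed.

Lemma others_genT (j0 : 'I_k) : others_gen j0 setT.
Proof.
exists (fun=> setT); split => //; first by move=> _; exact: borelRnT.
by apply/seteqP; split.
Qed.

Lemma single_gen_setI (j0 : 'I_k) : setI_closed (single_gen j0).
Proof.
move=> _ _ [A mA ->] [B mB ->]; exists (A `&` B) => //.
exact: borelRnI.
Qed.

Lemma single_genT (j0 : 'I_k) : single_gen j0 setT.
Proof. by exists setT => //; exact: borelRnT. Qed.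

Lemma measurable_others (j0 j : 'I_k) (l : 'I_L) : j != j0 ->
  measurable_fun setT (fun w : g_sigma_algebraType (others_gen j0) => Z j w l).
Proof.
move=> jj0 _ Y mY; rewrite setTI; apply: sub_sigma_algebra.
exists (fun j' => if j' == j then (fun v => v l) @^-1` Y else setT); split.
- move=> j'; case: ifP => _; last exact: borelRnT.
  by apply: sub_sigma_algebra; exists l => //; exists Y.
- by rewrite eq_sym (negPf jj0).
- apply/seteqP; split => [w Yw j' _|w h].
    by rewrite /preimage /=; case: eqP => [->|].
  by have := h j I; rewrite eqxx.
Qed.

Lemma measurable_single (j0 : 'I_k) (l : 'I_L) :
  measurable_fun setT (fun w : g_sigma_algebraType (single_gen j0) => Z j0 w l).
Proof.
move=> _ Y mY; rewrite setTI; apply: sub_sigma_algebra.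
exists ((fun v => v l) @^-1` Y) => //.
by apply: sub_sigma_algebra; exists l => //; exists Y.
Qed.

(** Putting D in place of the trivial constraint at [j0] turns the intersection into one event of
    the full family, whose probability factors. *)
Lemma indep_gen (j0 : 'I_k) (A B : set Omega) :
  indep_vectors P Z -> others_gen j0 A -> single_gen j0 B ->
  P (A `&` B) = (P A * P B)%E.
Proof.
move=> indep [C [mC C0 ->]] [D mD ->].
pose C' j := if j == j0 then D else C j.
have -> : \bigcap_(j in [set: 'I_k]) (Z j @^-1` C j) `&` Z j0 @^-1` D =
    \bigcap_(j in [set: 'I_k]) (Z j @^-1` C' j).
  apply/seteqP; split => [w [hC hD] j _|w h].
    by rewrite /C' /preimage /=; case: eqP => [->//|_]; exact: hC.
  split; last by have := h j0 I; rewrite /C' eqxx.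
  move=> j _; have := h j I; rewrite /C' /preimage /=.
  by case: eqP => [->|//]; rewrite C0.
rewrite !indep//; last by move=> j; rewrite /C'; case: ifP.
rewrite (bigD1 j0)//= [X in _ = (X * _)%E](bigD1 j0)//= C0 preimage_setT.
rewrite probability_setT mul1e /C' eqxx muleC; congr (_ * _)%E.
by apply: eq_bigr => j /negPf ->.
Qed.

(** The squared norm of [Z j0] stays explicit, since it equals 1 only almost surely. *)
Lemma sqnorm_sum_cons (j0 : 'I_k) (s : seq 'I_k) (w : Omega) :
  sqnorm_sum (j0 :: s) w = sqnorm_sum s w +
   (2 * \sum_(l < L) (al j0 * (\sum_(j <- s) al j * Z j w l) +
                     be j0 * (\sum_(j <- s) be j * Z j w l)) * Z j0 w l +
   (al j0 ^+ 2 + be j0 ^+ 2) * \sum_(l < L) Z j0 w l ^+ 2).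
Proof.
rewrite /sqnorm_sum !mulr_sumr -!big_split/=; apply: eq_bigr => l _.
by rewrite !big_cons; ring.
Qed.

Context (mZ : forall j l, measurable_fun setT (fun w => Z j w l))
  (indepZ : indep_vectors P Z) (uZ : forall j, uniform_on_sphere P (Z j))
  (L0 : (0 < L)%N).

Lemma others_gen_measurable (j0 : 'I_k) : others_gen j0 `<=` measurable.
Proof.
move=> _ [B [mB _ ->]]; apply: fin_bigcap_measurable => // j _.
exact: measurable_preimage_borelRn.
Qed.

Lemma single_gen_measurable (j0 : 'I_k) : single_gen j0 `<=` measurable.
Proof. by move=> _ [B mB ->]; exact: measurable_preimage_borelRn. Qed.

Lemma measurable_sqnorm_sum (s : seq 'I_k) : measurable_fun setT (sqnorm_sum s).
Proof.
apply: measurable_sum => l; apply: measurable_funD;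
  by apply: measurable_funX; apply: measurable_sum => j; exact: measurable_funM.
Qed.

(* One summand at a time: the factor exp (t |x|^2) becomes
   exp (t / (1 - 2 t |a_j|^2 / L) |x|^2), as for Gaussian vectors. *)
Lemma integral_sqnorm_cons (j0 : 'I_k) (s : seq 'I_k) (t : R) :
  j0 \notin s -> 0 <= t ->
  (\int[P]_w (expR (t * sqnorm_sum (j0 :: s) w))%:E <=
   (expR (t * (al j0 ^+ 2 + be j0 ^+ 2)))%:E * \int[P]_w
   (expR ((t + 2 * t ^+ 2 * (al j0 ^+ 2 + be j0 ^+ 2) / L%:R) * sqnorm_sum s w))%:E)%E.
Proof.
move=> j0s t0; set a2 := al j0 ^+ 2 + be j0 ^+ 2.
have L0' : 0 < L%:R :> R by rewrite ltr0n.
pose x w l := \sum_(j <- s) al j * Z j w l.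
pose y w l := \sum_(j <- s) be j * Z j w l.
pose v w l := 2 * t * (al j0 * x w l + be j0 * y w l).
(* The integrand as a function of two outcomes: the first drives the vectors indexed by s, the
   second drives [Z j0]. On the diagonal it is the original integrand. *)
pose f (z : g_sigma_algebraType (others_gen j0) * g_sigma_algebraType (single_gen j0)) : \bar R :=
  (expR (t * sqnorm_sum s z.1 + dot (v z.1) (Z j0 z.2)
    + t * a2 * \sum_(l < L) Z j0 z.2 l ^+ 2))%:E.
have mx (c : 'I_k -> R) l : measurable_fun setT
    (fun z : g_sigma_algebraType (others_gen j0) * g_sigma_algebraType (single_gen j0) =>
     \sum_(j <- s) c j * Z j z.1 l).
  apply: measurable_sum_in => j js; apply: measurable_funM => //.
  have jj0 : j != j0 by apply: contraNneq j0s => <-.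
  exact: (measurableT_comp (measurable_others l jj0) (@measurable_fst _ _ _ _)).
have mz l : measurable_fun setT
    (fun z : g_sigma_algebraType (others_gen j0) * g_sigma_algebraType (single_gen j0) =>
     Z j0 z.2 l).
  have := measurableT_comp (@measurable_single j0 l) (@measurable_snd _ _
    (g_sigma_algebraType (others_gen j0)) (g_sigma_algebraType (single_gen j0))).
  exact.
have mf : measurable_fun setT f.
  apply/measurable_EFinP; apply: measurableT_comp => //.
  apply: measurable_funD; first apply: measurable_funD.
  - apply: measurable_funM => //; apply: measurable_sum => l.
    by apply: measurable_funD; apply: measurable_funX; exact: mx.
  - apply: measurable_sum => l; apply: measurable_funM => //.
    apply: measurable_funM => //; apply: measurable_funD;
      by apply: measurable_funM => //; exact: mx.
  - apply: measurable_funM => //; apply: measurable_sum => l.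
    by apply: measurable_funX; exact: mz.
have f0 z : (0 <= f z)%E by rewrite lee_fin expR_ge0.
have -> : (\int[P]_w (expR (t * sqnorm_sum (j0 :: s) w))%:E = \int[P]_w f (w, w))%E.
  apply: eq_integral => w _; congr (expR _)%:E; rewrite sqnorm_sum_cons -/a2 /=.
  have -> : dot (v w) (Z j0 w) =
      t * (2 * \sum_(l < L) (al j0 * x w l + be j0 * y w l) * Z j0 w l).
    by rewrite /dot !mulr_sumr; apply: eq_bigr => l _; rewrite /v; ring.
  by rewrite /x /y; ring.
rewrite (indep_fubini (@others_gen_measurable j0) (@single_gen_measurable j0)
  (@others_gen_setI j0) (@single_gen_setI j0) (others_genT j0) (single_genT j0) _ mf f0);
  last by move=> A B; exact: indep_gen.
pose t' := t + 2 * t ^+ 2 * a2 / L%:R.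
have mS : measurable_fun setT (fun w => (expR (t' * sqnorm_sum s w))%:E).
  apply/measurable_EFinP; apply: measurableT_comp => //; apply: measurable_funM => //.
  exact: measurable_sqnorm_sum.
rewrite -/t' -ge0_integralZl_EFin ?expR_ge0//.
have inner w : (\int[P]_w' f (w, w') <=
    (expR (t * a2))%:E * (expR (t' * sqnorm_sum s w))%:E)%E.
  have -> : (\int[P]_w' f (w, w') =
      \int[P]_w' ((expR (t * sqnorm_sum s w + t * a2))%:E *
        (expR (dot (v w) (Z j0 w')))%:E))%E.
    apply: ae_eq_integral => //.
    - have : measurable_fun setT (f \o (fun w' => (w, w'))).
        by apply: measurableT_comp => //; exact: measurable_fun_pair.
      move=> /measurableT_comp.
      by apply; exact: measurable_id_g_sigma_algebra (@single_gen_measurable j0).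
    - apply: emeasurable_funM => //; apply/measurable_EFinP.
      by apply: measurableT_comp => //; exact: measurable_dot.
    apply: filterS (uniform_sphere_ae L0 (mZ j0) (uZ j0)) => w' Z1 _.
    by rewrite /f /= Z1 mulr1 -EFinM -expRD; congr (expR _)%:E; ring.
  rewrite ge0_integralZl_EFin ?expR_ge0//; last first.
    apply/measurable_EFinP.
    by apply: measurableT_comp => //; exact: measurable_dot.
  rewrite -/(mgf P (Z j0) (v w)).
  apply: le_trans (lee_wpmul2l _ (uniform_mgf_le (v w) L0 (mZ j0) (uZ j0))) _.
    by rewrite lee_fin expR_ge0.
  rewrite -!EFinM lee_fin -!expRD ler_expR.
  (* Cauchy-Schwarz in each coordinate, with remainder from the identity (a^2 + b^2) (x^2 + y^2) =
     (a x + b y)^2 + (a y - b x)^2. *)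
  have vle : \sum_(l < L) v w l ^+ 2 <= 4 * t ^+ 2 * a2 * sqnorm_sum s w.
    rewrite /sqnorm_sum mulr_sumr; apply: ler_sum => l _.
    rewrite -/(x w l) -/(y w l) /v.
    rewrite (_ : 4 * t ^+ 2 * a2 * (x w l ^+ 2 + y w l ^+ 2) =
       (2 * t * (al j0 * x w l + be j0 * y w l)) ^+ 2 +
       (2 * t * (al j0 * y w l - be j0 * x w l)) ^+ 2).
      by rewrite lerDl sqr_ge0.
    by rewrite /a2; ring.
  have : (\sum_(l < L) v w l ^+ 2) / (2 * L%:R) <=
      4 * t ^+ 2 * a2 * sqnorm_sum s w / (2 * L%:R).
    by rewrite ler_pM2r// invr_gt0 mulr_gt0.
  rewrite (_ : 4 * t ^+ 2 * a2 * sqnorm_sum s w / (2 * L%:R) =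
    2 * t ^+ 2 * a2 / L%:R * sqnorm_sum s w); last by field; rewrite gt_eqF.
  by rewrite /t'; lra.
apply: ge0_le_integral => //.
- by move=> w _; apply: integral_ge0.
- apply: measurable_partial_integral => //; first exact: others_gen_measurable.
  exact: single_gen_measurable.
- by apply: emeasurable_funM => //; apply/measurable_EFinP.
Qed.

End vector_sum.

(** Induction on s with t varying: removing one vector replaces t by t / (1 - y), and the factors 1
    - y multiply up to the argument of the logarithm. *)
Lemma integral_sqnorm_le d (Omega : measurableType d) (R : realType)
    (P : probability Omega R) (k L : nat) (al be : 'I_k -> R)
    (Z : 'I_k -> Omega -> 'I_L -> R) (s : seq 'I_k) (t : R) :
  (forall j l, measurable_fun setT (fun w => Z j w l)) ->
  indep_vectors P Z -> (forall j, uniform_on_sphere P (Z j)) -> (0 < L)%N ->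
  uniq s -> 0 <= t -> 2 * t * sqnorm_coef al be s < L%:R ->
  (\int[P]_w (expR (t * sqnorm_sum al be Z s w))%:E <=
   (expR (- (L%:R / 2 * ln (1 - 2 * t * sqnorm_coef al be s / L%:R))))%:E)%E.
Proof.
move=> mZ indepZ uZ L0; have L0' : 0 < L%:R :> R by rewrite ltr0n.
elim: s t => [|j0 s IH] t /=.
  move=> _ _ _; rewrite /sqnorm_coef big_nil mulr0 mul0r subr0 ln1 mulr0 oppr0 expR0.
  under eq_integral => w _.
    rewrite /sqnorm_sum (eq_bigr (fun=> 0)); last first.
      by move=> l _; rewrite !big_nil expr0n addr0.
    rewrite sumr_const mul0rn mulr0 expR0.
    over.
  by rewrite integral_cst//= probability_setT mule1.
move=> /andP[j0s us] t0.
rewrite /sqnorm_coef big_cons -/(sqnorm_coef al be s).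
set a2 := al j0 ^+ 2 + be j0 ^+ 2; set A := sqnorm_coef al be s => tA.
have a20 : 0 <= a2 by rewrite addr_ge0 ?sqr_ge0.
have A0 : 0 <= A by apply: sumr_ge0 => j _; rewrite addr_ge0 ?sqr_ge0.
have ta20 : 0 <= t * a2 by rewrite mulr_ge0.
have tA0 : 0 <= t * A by rewrite mulr_ge0.
pose y := 2 * t * a2 / L%:R.
have y0 : 0 <= y by rewrite divr_ge0// -mulrA mulr_ge0.
have y1 : y < 1 by rewrite ltr_pdivrMr// mul1r; lra.
have y1' : 0 < 1 - y by rewrite subr_gt0.
pose t' := t / (1 - y).
have t'0 : 0 <= t' by rewrite divr_ge0// ltW.
have D0 : 0 < 1 - 2 * t * (a2 + A) / L%:R by rewrite subr_gt0 ltr_pdivrMr// mul1r.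
(* This factorization makes the bounds telescope, and it shows that t' still satisfies the smallness
   condition for the shorter sequence. *)
have E : 1 - 2 * t' * A / L%:R = (1 - 2 * t * (a2 + A) / L%:R) / (1 - y).
  have -> : 1 - 2 * t * (a2 + A) / L%:R = (1 - y) - 2 * t * A / L%:R.
    by rewrite /y; ring.
  by rewrite /t'; field; rewrite !gt_eqF.
have t'A : 2 * t' * A < L%:R.
  have : 0 < 1 - 2 * t' * A / L%:R by rewrite E divr_gt0.
  by rewrite subr_gt0 ltr_pdivrMr// mul1r.
apply: le_trans (integral_sqnorm_cons al be mZ indepZ uZ L0 j0s t0) _.
rewrite -/a2.
(* The left side is t (1 + y), and (1 + y) (1 - y) <= 1. *)
have tt' : t + 2 * t ^+ 2 * a2 / L%:R <= t'.
  rewrite (_ : _ + _ = t * (1 + y)); last by rewrite /y; ring.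
  rewrite ler_pdivlMr// -mulrA ler_piMr//.
  by have := sqr_ge0 y; lra.
apply: (@le_trans _ _ ((expR (t * a2))%:E *
   (expR (- (L%:R / 2 * ln (1 - 2 * t' * A / L%:R))))%:E)%E).
  apply: lee_wpmul2l; first by rewrite lee_fin expR_ge0.
  apply: le_trans (IH t' us t'0 t'A).
  have mS c : measurable_fun setT (fun w => (expR (c * sqnorm_sum al be Z s w))%:E).
    apply/measurable_EFinP; apply: measurableT_comp => //; apply: measurable_funM => //.
    exact: measurable_sqnorm_sum.
  apply: ge0_le_integral => //.
  move=> w _; rewrite lee_fin ler_expR ler_wpM2r//.
  by apply: sumr_ge0 => l _; rewrite addr_ge0 ?sqr_ge0.
rewrite -EFinM lee_fin -expRD ler_expR E ln_div ?posrE//.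
(* Since t a2 = L y / 2, the factor exp (t a2) is at most (1 - y)^(-L/2). *)
have : ln (1 - y) <= - y by apply: le_ln1Dx; lra.
have : t * a2 = L%:R / 2 * y by rewrite /y; field; rewrite gt_eqF.
move=> ->; rewrite -(ler_pM2l (_ : 0 < L%:R / 2)); last by rewrite divr_gt0.
by move=> h; lra.
Qed.

(** * Chernoff bound for the norm of the sum *)

Theorem theorem2 (R : realType) (d : measure_display) (Omega : measurableType d)
  (P : probability Omega R) (k L : nat) (a : 'I_k -> R[i])
  (Z : 'I_k -> Omega -> 'I_L -> R) :
  a != 0 ->
  (forall j i, measurable_fun [set: Omega] (fun w => Z j w i)) ->
  indep_vectors P Z ->
  (forall j, uniform_on_sphere P (Z j)) ->
  forall u : R, 1 < u ->
  (P [set w | (u * cnorm a <= cnorm (fun i => \sum_(j < k) a j * Complex (Z j w i) 0))%R]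
   <= (expR (- ((L%:R / 2) * (u ^+ 2 - ln (u ^+ 2) - 1))))%:E)%E.
Proof.
move=> a0 mZ indepZ uZ u u1.
pose al j := complex.Re (a j); pose be j := complex.Im (a j).
pose s := index_enum (Finite.clone 'I_k _).
have u0 : 0 < u by exact: lt_trans u1.
pose A := sqnorm_coef al be s.
have A0 : 0 < A.
  rewrite lt_neqAle sumr_ge0 ?andbT; last by move=> j _; rewrite addr_ge0 ?sqr_ge0.
  apply: contraNneq a0 => /esym /eqP.
  rewrite psumr_eq0; last by move=> j _; rewrite addr_ge0 ?sqr_ge0.
  move=> /allP h; apply/eqP/funext => j.
  have := h j (mem_index_enum j); rewrite paddr_eq0 ?sqr_ge0// !sqrf_eq0 /al /be.
  by case: (a j) => x y /= /andP[/eqP -> /eqP ->].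
have normE w : cnorm (fun i => \sum_(j < k) a j * Complex (Z j w i) 0) =
    Num.sqrt (sqnorm_sum al be Z s w).
  congr Num.sqrt; apply: eq_bigr => l _; congr (_ ^+ 2 + _ ^+ 2).
    rewrite (raddf_sum (@complex.Re R)); apply: eq_bigr => j _.
    by rewrite /al; case: (a j) => x y /=; rewrite mulr0 subr0.
  rewrite (raddf_sum (@complex.Im R)); apply: eq_bigr => j _.
  by rewrite /be; case: (a j) => x y /=; rewrite mulr0 add0r.
have S0 w : 0 <= sqnorm_sum al be Z s w.
  by apply: sumr_ge0 => l _; rewrite addr_ge0 ?sqr_ge0.
pose E := [set w | u ^+ 2 * A <= sqnorm_sum al be Z s w].
have -> : [set w | u * cnorm a <= cnorm (fun i => \sum_(j < k) a j * Complex (Z j w i) 0)] = E.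
  apply/seteqP; split => w; rewrite /E /= normE;
    rewrite (_ : u * cnorm a = Num.sqrt (u ^+ 2 * A)) ?ler_sqrt//;
    by rewrite sqrtrM ?sqr_ge0// sqrtr_sqr gtr0_norm.
have mS : measurable_fun setT (sqnorm_sum al be Z s) by exact: measurable_sqnorm_sum.
have mE : measurable E.
  by have := mS measurableT _ (measurable_itv `[u ^+ 2 * A, +oo[); rewrite setTI set_itvE.
(* In dimension zero the right-hand side is exp 0 = 1. *)
have [L0|L0] := posnP L.
  by rewrite [X in expR X](_ : _ = 0) ?expR0 ?probability_le1// L0 !mul0r oppr0.
have L0' : 0 < L%:R :> R by rewrite ltr0n.
have v1 : u ^- 2 < 1 by rewrite invf_lt1 ?exprn_gt0// exprn_egt1.
(* The minimizer of - t u^2 A - (L/2) ln (1 - 2 t A / L): setting the derivative to zero gives 1 - 2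
   t A / L = u^(-2). *)
pose t := L%:R / (2 * A) * (1 - u ^- 2).
have t0 : 0 <= t by rewrite mulr_ge0 ?divr_ge0 ?mulr_ge0 ?subr_ge0// ltW.
have tA : 2 * t * A = L%:R * (1 - u ^- 2) by rewrite /t; field; rewrite !gt_eqF.
have tAL : 2 * t * A < L%:R.
  by rewrite tA gtr_pMr// gtrBl invr_gt0 exprn_gt0.
have := integral_sqnorm_le mZ indepZ uZ L0 (index_enum_uniq _) t0 tAL.
rewrite -/s -/A tA.
rewrite (_ : 1 - _ = u ^- 2); last by field; rewrite !gt_eqF.
rewrite lnV ?posrE ?exprn_gt0// => intle.
have mexp : measurable_fun setT (fun w => (expR (t * sqnorm_sum al be Z s w))%:E).
  by apply/measurable_EFinP; apply: measurableT_comp => //; apply: measurable_funM.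
have -> : P E = (\int[P]_w (\1_E w)%:E)%E by rewrite integral_indic// setIT.
(* Markov's inequality: the indicator of E is at most exp (t (S - u^2 A)), where S is the squared
   norm of the sum. *)
apply: (@le_trans _ _ (\int[P]_w ((expR (- (t * (u ^+ 2 * A))))%:E *
    (expR (t * sqnorm_sum al be Z s w))%:E))%E).
  apply: ge0_le_integral => //.
  - by apply/measurable_EFinP; exact: measurable_indic.
  - exact: emeasurable_funM.
  move=> w _; rewrite -EFinM lee_fin -expRD indicE.
  have [wE|wE] := boolP (w \in E); last by rewrite expR_ge0.
  move: wE; rewrite inE /E /= => wE.
  rewrite -expR0 ler_expR addrC subr_ge0.
  by rewrite ler_wpM2l.
rewrite ge0_integralZl_EFin ?expR_ge0//.
apply: le_trans (lee_wpmul2l _ intle) _; first by rewrite lee_fin expR_ge0.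
rewrite -EFinM lee_fin -expRD ler_expR.
rewrite (_ : t * (u ^+ 2 * A) = L%:R / 2 * (u ^+ 2 - 1)); first by lra.
by rewrite /t; field; rewrite !gt_eqF.
Qed.
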